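(* Let $Y$ be a reflexive asymptotically uniformly smooth Banach space, and assume that a Banach space $X$ coarse Lipschitz embeds into $Y$. Then $X$ has the Banach-Saks property.
   Context: All Banach spaces are real and infinite dimensional. For a map $f:(M,d)\to(N,\partial)$ between metric spaces, $\omega_f(t)=\sup\{\partial(f(x),f(y)) : d(x,y)\le t\}$ and $\rho_f(t)=\inf\{\partial(f(x),f(y)) : d(x,y)\ge t\}$. $f$ is a coarse Lipschitz embedding if there is $L>0$ with $\omega_f(t)\le Lt+L$ and $\rho_f(t)\ge L^{-1}t-L$ for all $t\ge 0$. The modulus of asymptotic uniform smoothness of a Banach space $Y$ is $\overline{\rho}_Y(t)=\sup_{x\in\partial B_Y}\inf_{\dim(Y/E)<\infty}\sup_{h\in\partial B_E}\|x+th\|-1$, where $E$ ranges over closed finite-codimensional subspaces and $\partial B$ denotes the unit sphere; $Y$ is asymptotically uniformly smooth if $\lim_{t\to0^+}\overline{\rho}_Y(t)/t=0$. A Banach space $X$ has the Banach-Saks property if every bounded sequence $(x_n)$ in $X$ has a subsequence $(x_{n_j})$ such that $(\frac1k\sum_{j=1}^k x_{n_j})_{k}$ converges in norm. *)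

(* Defs.v *)
From Stdlib Require Import Reals Lra List Classical ClassicalEpsilon.
Open Scope R_scope.

(** Supremum of a set of reals: the least upper bound when it exists
    (always the case for the nonempty bounded sets we apply it to). *)
Definition Rsup (P : R -> Prop) : R :=
  epsilon (inhabits 0) (fun l => is_lub P l).
Definition Rinf (P : R -> Prop) : R := - Rsup (fun r => P (- r)).

Record Banach := {
  carrier :> Type;
  vzero : carrier;
  vadd : carrier -> carrier -> carrier;
  vopp : carrier -> carrier;
  vscal : R -> carrier -> carrier;
  vnorm : carrier -> R;
  vadd_assoc : forall x y z, vadd x (vadd y z) = vadd (vadd x y) z;
  vadd_comm : forall x y, vadd x y = vadd y x;
  vadd_0 : forall x, vadd vzero x = x;
  vadd_opp : forall x, vadd x (vopp x) = vzero;
  vscal_addr : forall a x y, vscal a (vadd x y) = vadd (vscal a x) (vscal a y);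
  vscal_addl : forall a b x, vscal (a + b) x = vadd (vscal a x) (vscal b x);
  vscal_assoc : forall a b x, vscal a (vscal b x) = vscal (a * b) x;
  vscal_1 : forall x, vscal 1 x = x;
  vnorm_eq0 : forall x, vnorm x = 0 -> x = vzero;
  vnorm_scal : forall a x, vnorm (vscal a x) = Rabs a * vnorm x;
  vnorm_triangle : forall x y, vnorm (vadd x y) <= vnorm x + vnorm y;
  vcomplete : forall u : nat -> carrier,
      (forall eps, eps > 0 -> exists N, forall m n, (m >= N)%nat -> (n >= N)%nat ->
          vnorm (vadd (u m) (vopp (u n))) < eps) ->
      exists l, forall eps, eps > 0 -> exists N, forall n, (n >= N)%nat ->
          vnorm (vadd (u n) (vopp l)) < eps;
  vinfinite_dim : forall l : list carrier, exists x,
      forall c : list (R * carrier), (forall p, In p c -> In (snd p) l) ->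
        x <> fold_right (fun p acc => vadd (vscal (fst p) (snd p)) acc) vzero c
}.

Arguments vzero {_}.
Arguments vadd {_}.
Arguments vopp {_}.
Arguments vscal {_}.
Arguments vnorm {_}.

Definition vsub {X : Banach} (x y : X) : X := vadd x (vopp y).

Definition lincomb {X : Banach} (c : list (R * X)) : X :=
  fold_right (fun p acc => vadd (vscal (fst p) (snd p)) acc) vzero c.

Definition converges_to {X : Banach} (u : nat -> X) (l : X) : Prop :=
  forall eps, eps > 0 -> exists N, forall n, (n >= N)%nat -> vnorm (vsub (u n) l) < eps.

Definition closed_subspace {Y : Banach} (E : Y -> Prop) : Prop :=
  E vzero /\
  (forall x y, E x -> E y -> E (vadd x y)) /\
  (forall a x, E x -> E (vscal a x)) /\
  (forall (u : nat -> Y) l, (forall n, E (u n)) -> converges_to u l -> E l).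

Definition finite_codim {Y : Banach} (E : Y -> Prop) : Prop :=
  exists vs : list Y, forall y, exists e (c : list (R * Y)),
    E e /\ (forall p, In p c -> In (snd p) vs) /\ y = vadd e (lincomb c).

Definition mod_AUS (Y : Banach) (t : R) : R :=
  Rsup (fun r => exists x : Y, vnorm x = 1 /\
    r = Rinf (fun s => exists E : Y -> Prop, closed_subspace E /\ finite_codim E /\
          s = Rsup (fun u => exists h : Y, E h /\ vnorm h = 1 /\
                 u = vnorm (vadd x (vscal t h)) - 1))).

Definition AUS (Y : Banach) : Prop :=
  forall eps, eps > 0 -> exists delta, delta > 0 /\
    forall t, 0 < t < delta -> Rabs (mod_AUS Y t / t) < eps.

Definition bounded_linear_functional {X : Banach} (f : X -> R) : Prop :=
  (forall x y, f (vadd x y) = f x + f y) /\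
  (forall a x, f (vscal a x) = a * f x) /\
  (exists C, forall x, Rabs (f x) <= C * vnorm x).

Definition dual (X : Banach) := { f : X -> R | bounded_linear_functional f }.

Definition dual_norm {X : Banach} (f : dual X) : R :=
  Rsup (fun r => exists x : X, vnorm x <= 1 /\ r = Rabs (proj1_sig f x)).

Definition reflexive (X : Banach) : Prop :=
  forall Phi : dual X -> R,
    (forall f g : dual X, forall h : dual X,
        (forall x, proj1_sig h x = proj1_sig f x + proj1_sig g x) ->
        Phi h = Phi f + Phi g) ->
    (forall a (f h : dual X),
        (forall x, proj1_sig h x = a * proj1_sig f x) -> Phi h = a * Phi f) ->
    (exists C, forall f, Rabs (Phi f) <= C * dual_norm f) ->
    exists x : X, forall f : dual X, Phi f = proj1_sig f x.

(** Coarse Lipschitz embedding: omega_f(t) <= L t + L and rho_f(t) >= t/L - L. *)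
Definition coarse_lipschitz_embedding {X Y : Banach} (f : X -> Y) : Prop :=
  exists L, L > 0 /\
    (forall t, t >= 0 -> forall x y, vnorm (vsub x y) <= t ->
        vnorm (vsub (f x) (f y)) <= L * t + L) /\
    (forall t, t >= 0 -> forall x y, vnorm (vsub x y) >= t ->
        vnorm (vsub (f x) (f y)) >= t / L - L).

Definition coarse_lipschitz_embeds (X Y : Banach) : Prop :=
  exists f : X -> Y, coarse_lipschitz_embedding f.

Fixpoint vsum {X : Banach} (g : nat -> X) (k : nat) : X :=
  match k with
  | O => vzero
  | S k' => vadd (vsum g k') (g k')
  end.

Definition banach_saks (X : Banach) : Prop :=
  forall x : nat -> X, (exists M, forall n, vnorm (x n) <= M) ->
    exists phi : nat -> nat, (forall j, (phi j < phi (S j))%nat) /\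
      exists z : X, converges_to
        (fun k => vscal (/ INR (S k)) (vsum (fun j => x (phi j)) (S k))) z.

(* Main.v *)
Require Import Defs.
From Stdlib Require Import Reals Lra Lia List IndefiniteDescription ClassicalEpsilon.
From Coquelicot Require Import Coquelicot.
From mathcomp Require classical_sets filter.
Open Scope R_scope.

(** Fix a nonprincipal ultrafilter U on the integers. If F is a map from
    k-tuples of integers to Y that moves by at most L when one coordinate
    changes, reflexivity provides the iterated weak limits F_j(n_1, ..., n_j)
    of F in the variables n_k, ..., n_(j+1), and F - F_0 is a sum of k increments
    F_j - F_(j-1) of norm at most L, each weakly null along U in n_j. Weakly null
    vectors are nearly contained in any closed finite-codimensional subspace, so
    asymptotic uniform smoothness says that such an increment adds at most eps L
    to the norm of a long vector. Hence |F - F_0| <= O(L) + eps L k for U-almost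
    all n_1, ..., U-almost all n_k.

    Applied to (n_1, ..., n_k) |-> f (lam (x_(n_1) + ... + x_(n_k))), with f the
    embedding and lam large, this shows that almost all means of k terms of a
    bounded sequence (x_n) are within eta of a fixed vector. Diagonalising over
    eta yields a subsequence whose Cesaro means are Cauchy. *)

Declare Scope banach_scope.
Delimit Scope banach_scope with B.
Bind Scope banach_scope with carrier.
Arguments vadd {_} (_ _)%_B.
Arguments vsub {_} (_ _)%_B.
Arguments vopp {_} _%_B.
Arguments vscal {_} _%_R _%_B.
Arguments vnorm {_} _%_B.
Notation "0" := vzero : banach_scope.
Notation "x + y" := (vadd x y) : banach_scope.
Notation "- x" := (vopp x) : banach_scope.
Notation "x - y" := (vsub x y) : banach_scope.
Notation "a *: x" := (vscal a x) (at level 40) : banach_scope.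

(** * Linear identities between vectors *)

Lemma vadd_0_r {X : Banach} (x : X) : (x + 0)%B = x.
Proof. rewrite vadd_comm. apply vadd_0. Qed.

Lemma vadd_cancel_l {X : Banach} (x y z : X) : (x + y)%B = (x + z)%B -> y = z.
Proof.
  intros Hxyz.
  rewrite <- (vadd_0 _ y), <- (vadd_0 _ z), <- (vadd_opp _ x), (vadd_comm _ x).
  rewrite <- !vadd_assoc, Hxyz. reflexivity.
Qed.

Lemma vscal_0_l {X : Banach} (x : X) : (0 *: x)%B = 0%B.
Proof.
  apply (vadd_cancel_l (0 *: x)).
  rewrite <- vscal_addl, vadd_0_r. f_equal; lra.
Qed.

Lemma vscal_0_r {X : Banach} (a : R) : (a *: 0)%B = (0 : X)%B.
Proof.
  apply (vadd_cancel_l (a *: 0)).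
  rewrite <- vscal_addr, !vadd_0_r. reflexivity.
Qed.

Lemma vopp_vscal {X : Banach} (x : X) : (- x)%B = (-1 *: x)%B.
Proof.
  apply (vadd_cancel_l x). rewrite vadd_opp.
  rewrite <- (vscal_1 _ x) at 1. rewrite <- vscal_addl.
  replace (1 + -1) with 0 by lra. symmetry. apply vscal_0_l.
Qed.

Lemma vadd_swap {X : Banach} (a b c d : X) : (a + b + (c + d))%B = (a + c + (b + d))%B.
Proof.
  rewrite <- !vadd_assoc. f_equal. rewrite !vadd_assoc. f_equal. apply vadd_comm.
Qed.

Inductive vexpr :=
| VVar (n : nat)
| VZero
| VAdd (a b : vexpr)
| VOpp (a : vexpr)
| VScal (r : R) (a : vexpr).

Fixpoint veval {X : Banach} (env : list X) (e : vexpr) : X :=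
  match e with
  | VVar n => nth n env 0%B
  | VZero => 0
  | VAdd a b => veval env a + veval env b
  | VOpp a => - veval env a
  | VScal r a => r *: veval env a
  end.

Fixpoint vcoef (e : vexpr) (i : nat) : R :=
  match e with
  | VVar n => if Nat.eqb i n then 1 else 0
  | VZero => 0
  | VAdd a b => vcoef a i + vcoef b i
  | VOpp a => - vcoef a i
  | VScal r a => r * vcoef a i
  end.

Fixpoint vcombination {X : Banach} (env : list X) (c : nat -> R) : X :=
  match env with
  | nil => 0
  | x :: env' => c O *: x + vcombination env' (fun i => c (S i))
  end.

Fixpoint agree_on {A : Type} (env : list A) (c d : nat -> R) : Prop :=
  match env with
  | nil => True
  | _ :: env' => c O = d O /\ agree_on env' (fun i => c (S i)) (fun i => d (S i))
  end.

Lemma vcombination_ext {X : Banach} (env : list X) : forall c d,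
  agree_on env c d -> vcombination env c = vcombination env d.
Proof.
  induction env as [|x env IH]; simpl; intros c d Hcd; [reflexivity|].
  destruct Hcd as [-> Hcd]. f_equal. apply IH, Hcd.
Qed.

Lemma vcombination_zero {X : Banach} (env : list X) : vcombination env (fun _ => 0) = 0%B.
Proof.
  induction env as [|x env IH]; simpl; [reflexivity|].
  rewrite IH, vscal_0_l. apply vadd_0.
Qed.

Lemma vcombination_add {X : Banach} (env : list X) : forall c d,
  vcombination env (fun i => c i + d i) = (vcombination env c + vcombination env d)%B.
Proof.
  induction env as [|x env IH]; intros c d; simpl.
  - symmetry; apply vadd_0.
  - rewrite (IH (fun i => c (S i)) (fun i => d (S i))), vscal_addl. apply vadd_swap.
Qed.

Lemma vcombination_scal {X : Banach} (env : list X) : forall a c,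
  vcombination env (fun i => a * c i) = (a *: vcombination env c)%B.
Proof.
  induction env as [|x env IH]; intros a c; simpl.
  - symmetry; apply vscal_0_r.
  - rewrite (IH a (fun i => c (S i))), vscal_addr, vscal_assoc. reflexivity.
Qed.

Lemma vcombination_opp {X : Banach} (env : list X) : forall c,
  vcombination env (fun i => - c i) = (- vcombination env c)%B.
Proof.
  induction env as [|x env IH]; intros c; rewrite vopp_vscal; simpl.
  - symmetry; apply vscal_0_r.
  - rewrite (IH (fun i => c (S i))), vopp_vscal, vscal_addr, vscal_assoc.
    do 2 f_equal. ring.
Qed.

Lemma vcombination_var {X : Banach} (env : list X) : forall n,
  vcombination env (fun i => if Nat.eqb i n then 1 else 0) = nth n env 0%B.
Proof.
  induction env as [|x env IH]; intros [|n]; simpl; try reflexivity.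
  - rewrite vcombination_zero, vscal_1. apply vadd_0_r.
  - rewrite IH, vscal_0_l. apply vadd_0.
Qed.

Lemma veval_vcombination {X : Banach} (env : list X) (e : vexpr) :
  veval env e = vcombination env (vcoef e).
Proof.
  symmetry. induction e as [n| |a IHa b IHb|a IHa|r a IHa]; simpl.
  - apply vcombination_var.
  - apply vcombination_zero.
  - rewrite <- IHa, <- IHb. apply (vcombination_add env (vcoef a) (vcoef b)).
  - rewrite <- IHa. apply (vcombination_opp env (vcoef a)).
  - rewrite <- IHa. apply (vcombination_scal env r (vcoef a)).
Qed.

Lemma veval_eq {X : Banach} (env : list X) (a b : vexpr) :
  agree_on env (vcoef a) (vcoef b) -> veval env a = veval env b.
Proof. intros Hab. rewrite !veval_vcombination. apply vcombination_ext, Hab. Qed.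

Ltac vector_atoms e env :=
  lazymatch e with
  | vzero => env
  | vadd ?a ?b => let env' := vector_atoms a env in vector_atoms b env'
  | vsub ?a ?b => let env' := vector_atoms a env in vector_atoms b env'
  | vopp ?a => vector_atoms a env
  | vscal ?r ?a => vector_atoms a env
  | ?x => match env with
          | context [cons x _] => env
          | _ => constr:(cons x env)
          end
  end.

Ltac index_of x env :=
  lazymatch env with
  | cons x _ => constr:(O)
  | cons _ ?env' => let n := index_of x env' in constr:(S n)
  end.

Ltac reify_vector e env :=
  lazymatch e with
  | vzero => constr:(VZero)
  | vadd ?a ?b =>
      let a' := reify_vector a env in let b' := reify_vector b env in constr:(VAdd a' b')
  | vsub ?a ?b =>
      let a' := reify_vector a env in let b' := reify_vector b env in constr:(VAdd a' (VOpp b'))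
  | vopp ?a => let a' := reify_vector a env in constr:(VOpp a')
  | vscal ?r ?a => let a' := reify_vector a env in constr:(VScal r a')
  | ?x => let n := index_of x env in constr:(VVar n)
  end.

Ltac vector_eq :=
  lazymatch goal with
  | |- @eq (carrier ?X) ?a ?b =>
    let env := vector_atoms a (@nil (carrier X)) in
    let env := vector_atoms b env in
    let a' := reify_vector a env in
    let b' := reify_vector b env in
    change (veval env a' = veval env b');
    apply veval_eq; cbn [agree_on vcoef Nat.eqb];
    repeat split; try ring; try (field; lra)
  end.

(** * Norms *)

Lemma vnorm_zero {X : Banach} : vnorm (0 : X)%B = 0.
Proof. rewrite <- (vscal_0_l vzero), vnorm_scal, Rabs_R0. ring. Qed.

Lemma vnorm_opp {X : Banach} (x : X) : vnorm (- x) = vnorm x.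
Proof. rewrite vopp_vscal, vnorm_scal, Rabs_left by lra. ring. Qed.

Lemma vnorm_ge0 {X : Banach} (x : X) : 0 <= vnorm x.
Proof.
  pose proof (vnorm_triangle _ x (- x)%B) as Htriangle.
  rewrite vadd_opp, vnorm_zero, vnorm_opp in Htriangle. lra.
Qed.

Lemma vnorm_gt0 {X : Banach} (x : X) : x <> 0%B -> 0 < vnorm x.
Proof.
  intros Hx. destruct (vnorm_ge0 x) as [Hpos|Hzero]; [exact Hpos|].
  exfalso. apply Hx, vnorm_eq0. auto.
Qed.

Lemma vnorm_sub_sym {X : Banach} (x y : X) : vnorm (x - y) = vnorm (y - x).
Proof. rewrite <- vnorm_opp. f_equal. vector_eq. Qed.

Lemma vnorm_sub_le {X : Banach} (x y : X) : vnorm (x - y) <= vnorm x + vnorm y.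
Proof. rewrite <- (vnorm_opp y). apply vnorm_triangle. Qed.

Lemma vnorm_sub_triangle {X : Banach} (x y z : X) :
  vnorm (x - z) <= vnorm (x - y) + vnorm (y - z).
Proof.
  replace (x - z)%B with (x - y + (y - z))%B by vector_eq.
  apply vnorm_triangle.
Qed.

Lemma vnorm_scal_pos {X : Banach} (a : R) (x : X) : 0 <= a -> vnorm (a *: x) = a * vnorm x.
Proof. intros Ha. rewrite vnorm_scal, Rabs_pos_eq by exact Ha. reflexivity. Qed.

Lemma vnorm_normalize {X : Banach} (x : X) : x <> 0%B -> vnorm (/ vnorm x *: x) = 1.
Proof.
  intros Hx. apply vnorm_gt0 in Hx. rewrite vnorm_scal_pos.
  - field. lra.
  - apply Rlt_le, Rinv_0_lt_compat, Hx.
Qed.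

Lemma converges_to_of_approximate_limits {X : Banach} (u : nat -> X) :
  (forall eps, eps > 0 ->
     exists c N, forall n, (n >= N)%nat -> vnorm (u n - c) <= eps) ->
  exists z, converges_to u z.
Proof.
  intros Happrox. apply vcomplete. intros eps Heps.
  destruct (Happrox (eps / 3)) as [c [N HN]]; [lra|].
  exists N. intros m n Hm Hn. fold (vsub (u m) (u n)).
  pose proof (vnorm_sub_triangle (u m) c (u n)) as Htriangle.
  rewrite (vnorm_sub_sym c) in Htriangle.
  pose proof (HN m Hm). pose proof (HN n Hn). lra.
Qed.

(** * Infima of families of functionals *)

Lemma Rsup_is_lub (P : R -> Prop) (b : R) :
  (exists r, P r) -> (forall r, P r -> r <= b) -> is_lub P (Rsup P).
Proof.
  intros Hne Hb. unfold Rsup. apply epsilon_spec.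
  destruct (completeness P) as [l Hl]; [exists b; exact Hb|exact Hne|].
  exists l. exact Hl.
Qed.

Lemma le_Rsup (P : R -> Prop) (b r : R) : (forall r, P r -> r <= b) -> P r -> r <= Rsup P.
Proof.
  intros Hb Hr. apply (Rsup_is_lub P b); [exists r; exact Hr|exact Hb|exact Hr].
Qed.

Lemma Rsup_le (P : R -> Prop) (b : R) :
  (exists r, P r) -> (forall r, P r -> r <= b) -> Rsup P <= b.
Proof. intros Hne Hb. apply (Rsup_is_lub P b Hne Hb). exact Hb. Qed.

Lemma Rinf_le (P : R -> Prop) (b r : R) : (forall r, P r -> b <= r) -> P r -> Rinf P <= r.
Proof.
  intros Hb Hr. unfold Rinf.
  assert (Hsup : - r <= Rsup (fun r => P (- r))); [|lra].
  apply le_Rsup with (- b).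
  - intros s Hs. apply Hb in Hs. lra.
  - rewrite Ropp_involutive. exact Hr.
Qed.

Lemma le_Rinf (P : R -> Prop) (b : R) :
  (exists r, P r) -> (forall r, P r -> b <= r) -> b <= Rinf P.
Proof.
  intros [r Hr] Hb. unfold Rinf.
  assert (Hsup : Rsup (fun r => P (- r)) <= - b); [|lra].
  apply Rsup_le.
  - exists (- r). rewrite Ropp_involutive. exact Hr.
  - intros s Hs. apply Hb in Hs. lra.
Qed.

Lemma Rinf_lt_witness (P : R -> Prop) (c : R) :
  (exists r, P r) -> Rinf P < c -> exists r, P r /\ r < c.
Proof.
  intros Hne Hc. apply NNPP. intros Hno.
  assert (c <= Rinf P); [|lra].
  apply le_Rinf; [exact Hne|]. intros r Hr. apply Rnot_lt_le. intros Hlt.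
  apply Hno. exists r. auto.
Qed.

Definition pointwise_inf {I T : Type} (A : I -> Prop) (p : I -> T -> R) (x : T) : R :=
  Rinf (fun r => exists i, A i /\ r = p i x).

Lemma pointwise_inf_le {I T : Type} (A : I -> Prop) (p : I -> T -> R) (b : R) (x : T) (i : I) :
  (forall i, A i -> b <= p i x) -> A i -> pointwise_inf A p x <= p i x.
Proof.
  intros Hb Hi. apply Rinf_le with b.
  - intros r [j [Hj ->]]. apply Hb, Hj.
  - exists i. auto.
Qed.

Lemma le_pointwise_inf {I T : Type} (A : I -> Prop) (p : I -> T -> R) (b : R) (x : T) :
  (exists i, A i) -> (forall i, A i -> b <= p i x) -> b <= pointwise_inf A p x.
Proof.
  intros [i Hi] Hb. apply le_Rinf.
  - exists (p i x), i. auto.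
  - intros r [j [Hj ->]]. apply Hb, Hj.
Qed.

Lemma pointwise_inf_lt_witness {I T : Type} (A : I -> Prop) (p : I -> T -> R) (c : R) (x : T) :
  (exists i, A i) -> pointwise_inf A p x < c -> exists i, A i /\ p i x < c.
Proof.
  intros [i Hi] Hc.
  destruct (Rinf_lt_witness _ c (ex_intro _ (p i x) (ex_intro _ i (conj Hi eq_refl))) Hc)
    as [r [[j [Hj ->]] Hr]].
  exists j. auto.
Qed.

Definition sublinear {X : Banach} (p : X -> R) : Prop :=
  (forall x y, p (x + y)%B <= p x + p y) /\
  (forall t x, 0 <= t -> p (t *: x)%B <= t * p x).

Lemma sublinear_pointwise_inf {X : Banach} {I : Type} (A : I -> Prop) (p : I -> X -> R)
    (b : X -> R) :
  (exists i, A i) -> (forall i x, A i -> b x <= p i x) ->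
  (forall i j x y, A i -> A j -> exists k, A k /\ p k (x + y)%B <= p i x + p j y) ->
  (forall i t x, A i -> 0 <= t -> exists k, A k /\ p k (t *: x)%B <= t * p i x) ->
  sublinear (pointwise_inf A p).
Proof.
  intros Hne Hb Hadd Hscal.
  assert (Hle : forall i x, A i -> pointwise_inf A p x <= p i x).
  { intros i x. apply pointwise_inf_le with (b x). auto. }
  split.
  - intros x y.
    assert (Hleft : forall i, A i ->
              pointwise_inf A p (x + y)%B - p i x <= pointwise_inf A p y).
    { intros i Hi. apply le_pointwise_inf; [exact Hne|]. intros j Hj.
      destruct (Hadd i j x y Hi Hj) as [k [Hk Hij]].
      pose proof (Hle k (x + y)%B Hk). lra. }
    assert (Hright : pointwise_inf A p (x + y)%B - pointwise_inf A p y <= pointwise_inf A p x);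
      [|lra].
    apply le_pointwise_inf; [exact Hne|]. intros i Hi. specialize (Hleft i Hi). lra.
  - intros t x Ht.
    assert (Hbound : forall i, A i -> pointwise_inf A p (t *: x)%B <= p i x * t).
    { intros i Hi. destruct (Hscal i t x Hi Ht) as [k [Hk Hki]].
      pose proof (Hle k (t *: x)%B Hk). lra. }
    destruct Ht as [Ht| <-].
    + rewrite Rmult_comm. apply Rle_div_l; [exact Ht|].
      apply le_pointwise_inf; [exact Hne|]. intros i Hi.
      apply Rle_div_l; [exact Ht|apply Hbound, Hi].
    + destruct Hne as [i Hi]. specialize (Hbound i Hi). lra.
Qed.

Lemma sublinear_zero {X : Banach} (p : X -> R) : sublinear p -> p 0%B = 0.
Proof.
  intros [Hadd Hscal]. specialize (Hadd 0%B 0%B). rewrite vadd_0 in Hadd.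
  specialize (Hscal 0 0%B (Rle_refl 0)). rewrite vscal_0_l in Hscal. lra.
Qed.

Lemma sublinear_scal {X : Banach} (p : X -> R) (t : R) (x : X) :
  sublinear p -> 0 <= t -> p (t *: x)%B = t * p x.
Proof.
  intros Hp [Ht| <-].
  - apply Rle_antisym; [apply Hp; lra|].
    rewrite Rmult_comm. apply Rle_div_r; [exact Ht|].
    replace x with (/ t *: (t *: x))%B at 1 by vector_eq.
    unfold Rdiv. rewrite Rmult_comm. apply Hp, Rlt_le, Rinv_0_lt_compat, Ht.
  - rewrite vscal_0_l, sublinear_zero by exact Hp. ring.
Qed.

Lemma sublinear_ge_opp {X : Banach} (p : X -> R) (x : X) : sublinear p -> - p (- x)%B <= p x.
Proof.
  intros Hp. pose proof (proj1 Hp x (- x)%B) as Hadd.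
  rewrite vadd_opp, sublinear_zero in Hadd by exact Hp. lra.
Qed.

Definition seminorm {X : Banach} (p : X -> R) : Prop :=
  sublinear p /\ forall x, p (- x)%B <= p x.

Lemma seminorm_ge0 {X : Banach} (p : X -> R) (x : X) : seminorm p -> 0 <= p x.
Proof.
  intros [Hp Heven]. pose proof (sublinear_ge_opp p x Hp). specialize (Heven x). lra.
Qed.

Lemma seminorm_scal_le {X : Banach} (p : X -> R) (a : R) (x : X) :
  seminorm p -> p (a *: x)%B <= Rabs a * p x.
Proof.
  intros [Hp Heven]. destruct (Rle_lt_dec 0 a) as [Ha|Ha].
  - rewrite Rabs_pos_eq by exact Ha. apply Hp, Ha.
  - rewrite Rabs_left by exact Ha. replace (a *: x)%B with (- (- a *: x))%B by vector_eq.
    apply Rle_trans with (p (- a *: x)%B); [apply Heven|]. apply Hp. lra.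
Qed.

Lemma seminorm_vnorm (X : Banach) : seminorm (@vnorm X).
Proof.
  split; [split|].
  - apply vnorm_triangle.
  - intros t x Ht. right. apply vnorm_scal_pos, Ht.
  - intros x. right. apply vnorm_opp.
Qed.

(** * The Hahn-Banach theorem *)

Lemma zorn_preorder {T : Type} (P : T -> Prop) (prec : T -> T -> Prop) :
  (exists t, P t) -> (forall t, prec t t) ->
  (forall r s t, prec r s -> prec s t -> prec r t) ->
  (forall A : T -> Prop, (exists a, A a) -> (forall a, A a -> P a) ->
     (forall a b, A a -> A b -> prec a b \/ prec b a) ->
     exists t, P t /\ forall a, A a -> prec a t) ->
  exists t, P t /\ forall s, P s -> prec t s -> prec s t.
Proof.
  intros [t0 Ht0] Hrefl Htrans Hchain.
  destruct (@classical_sets.ZL_preorder {t | P t} (exist _ t0 Ht0)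
              (fun s t => boolp.asbool (prec (proj1_sig s) (proj1_sig t)))) as [[t Ht] Hmax].
  - intros t. apply boolp.asboolT, Hrefl.
  - intros r s t Hrs Hst. apply boolp.asboolT.
    apply Htrans with (proj1_sig s); apply boolp.asboolW; assumption.
  - intros A HA. destruct (classic (exists a, A a)) as [[a Ha]|Hempty].
    + destruct (Hchain (fun t => exists Pt : P t, A (exist _ t Pt))) as [t [Ht Hub]].
      * exists (proj1_sig a), (proj2_sig a). destruct a. exact Ha.
      * intros s [Ps _]. exact Ps.
      * intros s t [Ps As] [Pt At].
        destruct (HA _ _ As At) as [Hst|Hts]; [left|right]; apply boolp.asboolW; assumption.
      * exists (exist _ t Ht). intros [s Ps] As. apply boolp.asboolT, Hub. exists Ps. exact As.
    + exists (exist _ t0 Ht0). intros s Hs. exfalso. apply Hempty. exists s. exact Hs.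
  - exists t. split; [exact Ht|]. intros s Ps Hts. apply boolp.asboolW.
    apply (Hmax (exist _ s Ps)). apply boolp.asboolT, Hts.
Qed.

Lemma sublinear_chain_inf {X : Banach} (A : (X -> R) -> Prop) (b : X -> R) :
  (exists p, A p) -> (forall p, A p -> sublinear p) -> (forall p x, A p -> b x <= p x) ->
  (forall p q, A p -> A q -> (forall x, q x <= p x) \/ (forall x, p x <= q x)) ->
  sublinear (pointwise_inf A (fun p => p)).
Proof.
  intros Hne HA Hb Hchain.
  apply sublinear_pointwise_inf with b; [exact Hne|exact Hb| |].
  - intros p q x y Hp Hq. destruct (Hchain p q Hp Hq) as [Hle|Hle].
    + exists q. split; [exact Hq|].
      pose proof (proj1 (HA q Hq) x y). specialize (Hle x). lra.
    + exists p. split; [exact Hp|].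
      pose proof (proj1 (HA p Hp) x y). specialize (Hle y). lra.
  - intros p t x Hp Ht. exists p. split; [exact Hp|]. apply (HA p Hp), Ht.
Qed.

Lemma minimal_sublinear {X : Banach} (q : X -> R) : sublinear q ->
  exists p, sublinear p /\ (forall x, p x <= q x) /\
    forall p', sublinear p' -> (forall x, p' x <= p x) -> forall x, p x <= p' x.
Proof.
  intros Hq.
  destruct (zorn_preorder (fun p => sublinear p /\ forall x, p x <= q x)
              (fun p p' => forall x, p' x <= p x)) as [p [[Hp Hpq] Hmin]].
  - exists q. split; [exact Hq|]. intros x. apply Rle_refl.
  - intros p x. apply Rle_refl.
  - intros p p' p'' Hpp' Hp'p'' x. apply Rle_trans with (p' x); auto.
  - intros A [a Ha] HA Hchain.
    assert (Hlow : forall p x, A p -> - q (- x)%B <= p x).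
    { intros p x Hp. destruct (HA p Hp) as [Hsub Hle].
      pose proof (sublinear_ge_opp p x Hsub). specialize (Hle (- x)%B). lra. }
    assert (Hinf : forall p, A p -> forall x, pointwise_inf A (fun p => p) x <= p x).
    { intros p Hp x. apply (pointwise_inf_le A (fun p => p) (- q (- x)%B)); auto. }
    exists (pointwise_inf A (fun p => p)). split; [split|exact Hinf].
    + apply sublinear_chain_inf with (fun x => - q (- x)%B);
        [exists a; exact Ha|apply HA|exact Hlow|exact Hchain].
    + intros x. apply Rle_trans with (a x); [apply Hinf, Ha|apply HA, Ha].
  - exists p. split; [exact Hp|]. split; [exact Hpq|]. intros p' Hp' Hle.
    apply Hmin; [split; [exact Hp'|]|exact Hle].
    intros x. apply Rle_trans with (p x); auto.
Qed.

(* The largest sublinear functional below [p] that sends [- y] to [- p y]. *)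
Definition linearize_along {X : Banach} (p : X -> R) (y : X) : X -> R :=
  pointwise_inf (fun t => 0 <= t) (fun t x => p (x + t *: y)%B - t * p y).

Section LinearizeAlong.

Context {X : Banach} (p : X -> R) (y : X).
Hypothesis p_sublinear : sublinear p.

Lemma linearize_along_lower (t : R) (x : X) : 0 <= t ->
  - p (- x)%B <= p (x + t *: y)%B - t * p y.
Proof.
  intros Ht. pose proof (proj1 p_sublinear (x + t *: y)%B (- x)%B) as Hadd.
  replace (x + t *: y + - x)%B with (t *: y)%B in Hadd by vector_eq.
  rewrite sublinear_scal in Hadd by assumption. lra.
Qed.

Lemma linearize_along_le (x : X) (t : R) : 0 <= t ->
  linearize_along p y x <= p (x + t *: y)%B - t * p y.
Proof.
  apply (pointwise_inf_le _ (fun t x => p (x + t *: y)%B - t * p y) (- p (- x)%B)).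
  intros s. apply linearize_along_lower.
Qed.

Lemma linearize_along_below (x : X) : linearize_along p y x <= p x.
Proof.
  pose proof (linearize_along_le x 0 (Rle_refl 0)) as Hle.
  rewrite vscal_0_l, vadd_0_r in Hle. lra.
Qed.

Lemma linearize_along_opp : linearize_along p y (- y)%B <= - p y.
Proof.
  pose proof (linearize_along_le (- y)%B 1 ltac:(lra)) as Hle.
  replace (- y + 1 *: y)%B with (0 : X)%B in Hle by vector_eq.
  rewrite sublinear_zero in Hle by exact p_sublinear. lra.
Qed.

Lemma sublinear_linearize_along : sublinear (linearize_along p y).
Proof.
  apply sublinear_pointwise_inf with (fun x => - p (- x)%B).
  - exists 0. lra.
  - intros t x. apply linearize_along_lower.
  - intros s t x z Hs Ht. exists (s + t). split; [lra|].
    pose proof (proj1 p_sublinear (x + s *: y)%B (z + t *: y)%B) as Hadd.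
    replace (x + s *: y + (z + t *: y))%B with (x + z + (s + t) *: y)%B in Hadd by vector_eq.
    lra.
  - intros s t x Hs Ht. exists (t * s). split; [apply Rmult_le_pos; assumption|].
    replace (t *: x + (t * s) *: y)%B with (t *: (x + s *: y))%B by vector_eq.
    rewrite sublinear_scal by assumption. lra.
Qed.

End LinearizeAlong.

Definition linear_functional {X : Banach} (f : X -> R) : Prop :=
  (forall x y, f (x + y)%B = f x + f y) /\ (forall a x, f (a *: x)%B = a * f x).

Lemma hahn_banach {X : Banach} (q : X -> R) : sublinear q ->
  exists f, linear_functional f /\ forall x, f x <= q x.
Proof.
  intros Hq. destruct (minimal_sublinear q Hq) as [f [Hf [Hfq Hmin]]].
  exists f. split; [|exact Hfq].
  assert (Hodd : forall y, f (- y)%B = - f y).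
  { intros y. pose proof (sublinear_ge_opp f y Hf).
    pose proof (Hmin _ (sublinear_linearize_along f y Hf) (linearize_along_below f y Hf) (- y)%B).
    pose proof (linearize_along_opp f y Hf). lra. }
  split.
  - intros x y. apply Rle_antisym; [apply Hf|].
    pose proof (proj1 Hf (- x)%B (- y)%B) as Hadd.
    replace (- x + - y)%B with (- (x + y))%B in Hadd by vector_eq.
    rewrite !Hodd in Hadd. lra.
  - intros a x. destruct (Rle_lt_dec 0 a) as [Ha|Ha].
    + apply sublinear_scal; assumption.
    + replace (a *: x)%B with (- (- a *: x))%B by vector_eq.
      rewrite Hodd, sublinear_scal by (assumption || lra). ring.
Qed.

Lemma dominated_linear_functional {X : Banach} (q : X -> R) (y : X) : seminorm q ->
  exists f, linear_functional f /\ f y = q y /\ forall x, Rabs (f x) <= q x.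
Proof.
  intros [Hq Heven].
  destruct (hahn_banach (linearize_along q y)) as [f [Hf Hfq]].
  { apply sublinear_linearize_along, Hq. }
  assert (Hle : forall x, f x <= q x).
  { intros x. apply Rle_trans with (1 := Hfq x), linearize_along_below, Hq. }
  assert (Hopp : forall x, f (- x)%B = - f x).
  { intros x. rewrite vopp_vscal, (proj2 Hf). ring. }
  exists f. split; [exact Hf|]. split.
  - apply Rle_antisym; [apply Hle|].
    pose proof (Hfq (- y)%B) as Hfy. pose proof (linearize_along_opp q y Hq).
    rewrite Hopp in Hfy. lra.
  - intros x. apply Rabs_le_between. split; [|apply Hle].
    pose proof (Hle (- x)%B) as Hfx. specialize (Heven x). rewrite Hopp in Hfx. lra.
Qed.

(** * Limits along ultrafilters *)

Lemma filterlim_locally_R {I : Type} (F : (I -> Prop) -> Prop) {HF : Filter F}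
    (a : I -> R) (l : R) :
  filterlim a F (locally l) <-> forall eps, eps > 0 -> F (fun i => Rabs (a i - l) < eps).
Proof.
  split.
  - intros Ha eps Heps. exact (proj1 (filterlim_locally a l) Ha (mkposreal eps Heps)).
  - intros Ha. apply filterlim_locally. intros [eps Heps]. exact (Ha eps Heps).
Qed.

Lemma filter_forall_lt {I : Type} (F : (I -> Prop) -> Prop) {HF : Filter F}
    (A : nat -> I -> Prop) (N : nat) :
  (forall j, (j < N)%nat -> F (A j)) -> F (fun i => forall j, (j < N)%nat -> A j i).
Proof.
  induction N as [|N IH]; intros HA.
  - apply filter_forall. intros i j Hj. lia.
  - apply filter_imp with (fun i => (forall j, (j < N)%nat -> A j i) /\ A N i).
    + intros i [Hlt HN] j Hj. destruct (Nat.eq_dec j N) as [->|Hne]; [exact HN|].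
      apply Hlt. lia.
    + apply filter_and; [apply IH; intros j Hj|]; apply HA; lia.
Qed.

Class Ultrafilter {I : Type} (U : (I -> Prop) -> Prop) : Prop := {
  ultrafilter_proper :: ProperFilter U;
  ultrafilter_or_not : forall A : I -> Prop, U A \/ U (fun i => ~ A i)
}.

Lemma ultrafilter_refinement {I : Type} (F : (I -> Prop) -> Prop) {HF : ProperFilter F} :
  exists U, Ultrafilter U /\ filter_le U F.
Proof.
  assert (HF' : filter.ProperFilter F).
  { split.
    - intros Hempty. destruct (filter_ex _ Hempty) as [i []].
    - split.
      + exact filter_true.
      + exact filter_and.
      + exact filter_imp. }
  destruct (filter.ultraFilterLemma HF') as [U [HU HFU]].
  pose proof (filter.ultra_proper (UltraFilter := HU)) as Hproper.
  pose proof (filter.filter_filter (ProperFilter := Hproper)) as Hfilter.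
  exists U. split; [|exact HFU].
  split; [split; [|split]|].
  - intros A HA. apply NNPP. intros Hno.
    apply (filter.filter_not_empty U (ProperFilter := Hproper)).
    refine (filter.filterS (Filter := Hfilter) _ HA).
    intros i Hi. apply Hno. exists i. exact Hi.
  - exact (filter.filterT (Filter := Hfilter)).
  - intros A B HA HB. exact (filter.filterI (Filter := Hfilter) HA HB).
  - intros A B HAB HA. exact (filter.filterS (Filter := Hfilter) HAB HA).
  - intros A. exact (filter.in_ultra_setVsetC A HU).
Qed.

Lemma ultrafilter_bounded_converges {I : Type} (U : (I -> Prop) -> Prop) {HU : Ultrafilter U}
    (a : I -> R) (C : R) :
  (forall i, Rabs (a i) <= C) -> exists l, filterlim a U (locally l).
Proof.
  intros Ha.
  assert (Hbounds : forall i, - C <= a i <= C).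
  { intros i. apply Rabs_le_between, Ha. }
  destruct (completeness (fun r => U (fun i => r <= a i))) as [l [Hub Hleast]].
  - exists C. intros r Hr. destruct (filter_ex _ Hr) as [i Hi]. specialize (Hbounds i). lra.
  - exists (- C). apply filter_forall. intros i. apply Hbounds.
  - exists l. apply filterlim_locally_R; [exact _|]. intros eps Heps.
    assert (Habove : U (fun i => a i < l + eps)).
    { destruct (ultrafilter_or_not (fun i => l + eps <= a i)) as [Hge|Hlt].
      - apply Hub in Hge. lra.
      - apply (filter_imp _ _ (fun i => Rnot_le_lt _ _) Hlt). }
    assert (Hbelow : exists r, U (fun i => r <= a i) /\ l - eps < r).
    { apply NNPP. intros Hno. assert (l <= l - eps); [|lra].
      apply Hleast. intros r Hr. apply Rnot_lt_le. intros Hlt. apply Hno. exists r. auto. }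
    destruct Hbelow as [r [Hr Hlr]].
    apply filter_imp with (fun i => a i < l + eps /\ r <= a i).
    + intros i Hi. apply Rabs_lt_between. lra.
    + apply filter_and; assumption.
Qed.

(** * Weak limits *)

Definition dual_fun {X : Banach} (f : dual X) : X -> R := proj1_sig f.
Coercion dual_fun : dual >-> Funclass.

Lemma dual_add {X : Banach} (f : dual X) (x y : X) : f (x + y)%B = f x + f y.
Proof. apply (proj2_sig f). Qed.

Lemma dual_scal {X : Banach} (f : dual X) (a : R) (x : X) : f (a *: x)%B = a * f x.
Proof. apply (proj2_sig f). Qed.

Lemma dual_zero {X : Banach} (f : dual X) : f 0%B = 0.
Proof. rewrite <- (vscal_0_l vzero), dual_scal. ring. Qed.

Lemma dual_sub {X : Banach} (f : dual X) (x y : X) : f (x - y)%B = f x - f y.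
Proof. unfold vsub. rewrite vopp_vscal, dual_add, dual_scal. ring. Qed.

Lemma le_dual_norm {X : Banach} (f : dual X) (x : X) :
  vnorm x <= 1 -> Rabs (f x) <= dual_norm f.
Proof.
  intros Hx. destruct (proj2 (proj2 (proj2_sig f))) as [C HC].
  apply le_Rsup with (Rabs C); [|exists x; auto].
  intros r [y [Hy ->]]. apply Rle_trans with (C * vnorm y); [apply HC|].
  pose proof (Rle_abs C). pose proof (Rabs_pos C). pose proof (vnorm_ge0 y). nra.
Qed.

Lemma dual_norm_ge0 {X : Banach} (f : dual X) : 0 <= dual_norm f.
Proof.
  apply Rle_trans with (Rabs (f 0%B)); [apply Rabs_pos|].
  apply le_dual_norm. rewrite vnorm_zero. lra.
Qed.

Lemma dual_le_dual_norm {X : Banach} (f : dual X) (x : X) :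
  Rabs (f x) <= dual_norm f * vnorm x.
Proof.
  destruct (classic (x = 0%B)) as [->|Hx].
  - rewrite dual_zero, vnorm_zero, Rabs_R0. lra.
  - assert (Hunit : Rabs (f (/ vnorm x *: x)%B) <= dual_norm f).
    { apply le_dual_norm. rewrite vnorm_normalize by exact Hx. lra. }
    apply vnorm_gt0 in Hx. apply Rle_div_l; [exact Hx|].
    rewrite dual_scal, Rabs_mult, Rabs_pos_eq in Hunit
      by (apply Rlt_le, Rinv_0_lt_compat, Hx).
    unfold Rdiv. lra.
Qed.

Lemma norming_functional {X : Banach} (q : X -> R) (C : R) (y : X) :
  seminorm q -> (forall x, q x <= C * vnorm x) ->
  exists f : dual X, f y = q y /\ forall x, Rabs (f x) <= q x.
Proof.
  intros Hq HC. destruct (dominated_linear_functional q y Hq) as [f [[Hadd Hscal] [Hfy Hfq]]].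
  assert (Hf : bounded_linear_functional f).
  { split; [exact Hadd|]. split; [exact Hscal|]. exists C.
    intros x. apply Rle_trans with (q x); auto. }
  exists (exist _ f Hf). split; assumption.
Qed.

Definition weak_limit {I : Type} {Y : Banach} (F : (I -> Prop) -> Prop) (u : I -> Y) (y : Y) :
    Prop :=
  forall f : dual Y, filterlim (fun i => f (u i)) F (locally (f y)).

Lemma weak_limit_const {I : Type} {Y : Banach} (F : (I -> Prop) -> Prop) {HF : Filter F} (y : Y) :
  weak_limit F (fun _ => y) y.
Proof. intros f. apply filterlim_const. Qed.

Lemma weak_limit_sub {I : Type} {Y : Banach} (F : (I -> Prop) -> Prop) {HF : Filter F}
    (u v : I -> Y) (y z : Y) :
  weak_limit F u y -> weak_limit F v z -> weak_limit F (fun i => u i - v i)%B (y - z)%B.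
Proof.
  intros Hu Hv f. rewrite dual_sub.
  apply filterlim_ext with (fun i => f (u i) - f (v i)).
  - intros i. symmetry. apply dual_sub.
  - apply (filterlim_comp_2 (fun i => f (u i)) (fun i => - f (v i)) Rplus (Hu f)
             (filterlim_comp _ _ _ _ _ _ _ _ (Hv f) (filterlim_opp (f z)))
             (filterlim_plus (f y) (- f z))).
Qed.

Lemma weak_limit_dist_le {I : Type} {Y : Banach} (F : (I -> Prop) -> Prop) {HF : ProperFilter F}
    (u v : I -> Y) (y z : Y) (C : R) :
  weak_limit F u y -> weak_limit F v z -> F (fun i => vnorm (u i - v i) <= C) ->
  vnorm (y - z) <= C.
Proof.
  intros Hu Hv HC.
  destruct (norming_functional vnorm 1 (y - z)%B (seminorm_vnorm Y)) as [f [Hf Hfle]].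
  { intros x. lra. }
  rewrite <- Hf.
  apply (filterlim_le (F := F) (fun i => f (u i - v i)%B) (fun _ => C) (f (y - z)%B) C).
  - revert HC. apply filter_imp. intros i Hi.
    apply Rle_trans with (1 := Rle_abs _), Rle_trans with (2 := Hi), Hfle.
  - exact (weak_limit_sub F u v y z Hu Hv f).
  - apply filterlim_const.
Qed.

Lemma bounded_weak_limit_exists {I : Type} {Y : Banach} (U : (I -> Prop) -> Prop)
    {HU : Ultrafilter U} (u : I -> Y) (C : R) :
  reflexive Y -> (forall i, vnorm (u i) <= C) -> exists y, weak_limit U u y.
Proof.
  intros Hreflexive Hu.
  assert (Hbounded : forall (f : dual Y) i, Rabs (f (u i)) <= C * dual_norm f).
  { intros f i. apply Rle_trans with (1 := dual_le_dual_norm f (u i)).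
    pose proof (dual_norm_ge0 f). specialize (Hu i). nra. }
  destruct (functional_choice (fun f l => filterlim (fun i => dual_fun f (u i)) U (locally l)))
    as [Phi HPhi].
  { intros f. apply (ultrafilter_bounded_converges U _ (C * dual_norm f)), Hbounded. }
  destruct (Hreflexive Phi) as [y Hy].
  - intros f g h Hh.
    apply (filterlim_locally_unique (fun i => h (u i)) _ _ (HPhi h)).
    apply filterlim_ext with (fun i => f (u i) + g (u i)).
    + intros i. symmetry. apply Hh.
    + apply (filterlim_comp_2 _ _ Rplus (HPhi f) (HPhi g) (filterlim_plus (Phi f) (Phi g))).
  - intros a f h Hh.
    apply (filterlim_locally_unique (fun i => h (u i)) _ _ (HPhi h)).
    apply filterlim_ext with (fun i => a * f (u i)).
    + intros i. symmetry. apply Hh.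
    + apply (filterlim_comp _ _ _ _ _ _ _ _ (HPhi f) (filterlim_scal_r a (Phi f))).
  - exists C. intros f.
    apply (filterlim_le (F := U) (fun i => Rabs (f (u i))) (fun _ => C * dual_norm f)
             (Rabs (Phi f)) (C * dual_norm f)).
    + apply filter_forall, Hbounded.
    + apply (filterlim_comp _ _ _ _ _ _ _ _ (HPhi f) (continuous_Rabs (Phi f))).
    + apply filterlim_const.
  - exists y. intros f. change (f y) with (proj1_sig f y). rewrite <- Hy. apply HPhi.
Qed.

(** * Distance to subspaces of finite codimension *)

Definition linear_subspace {Y : Banach} (E : Y -> Prop) : Prop :=
  E 0%B /\ (forall x y, E x -> E y -> E (x + y)%B) /\ (forall a x, E x -> E (a *: x)%B).

Lemma closed_subspace_linear {Y : Banach} (E : Y -> Prop) :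
  closed_subspace E -> linear_subspace E.
Proof. intros [Hzero [Hadd [Hscal _]]]. exact (conj Hzero (conj Hadd Hscal)). Qed.

Definition dist_to {Y : Banach} (E : Y -> Prop) : Y -> R :=
  pointwise_inf E (fun e y => vnorm (y - e)).

Lemma dist_to_le {Y : Banach} (E : Y -> Prop) (y e : Y) : E e -> dist_to E y <= vnorm (y - e).
Proof.
  apply (pointwise_inf_le E (fun e y => vnorm (y - e)) 0). intros z _. apply vnorm_ge0.
Qed.

Lemma dist_to_mem {Y : Banach} (E : Y -> Prop) (y : Y) : E y -> dist_to E y <= 0.
Proof.
  intros Hy. apply Rle_trans with (1 := dist_to_le E y y Hy).
  replace (y - y)%B with (0 : Y)%B by vector_eq. rewrite vnorm_zero. lra.
Qed.

Lemma dist_to_le_vnorm {Y : Banach} (E : Y -> Prop) (y : Y) : E 0%B -> dist_to E y <= vnorm y.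
Proof.
  intros Hzero. replace y with (y - 0)%B at 2 by vector_eq. apply dist_to_le, Hzero.
Qed.

Lemma seminorm_dist_to {Y : Banach} (E : Y -> Prop) : linear_subspace E -> seminorm (dist_to E).
Proof.
  intros [Hzero [Hadd Hscal]]. split.
  - apply sublinear_pointwise_inf with (fun _ => 0).
    + exists 0%B. exact Hzero.
    + intros e y _. apply vnorm_ge0.
    + intros e e' x y He He'. exists (e + e')%B. split; [auto|].
      replace (x + y - (e + e'))%B with (x - e + (y - e'))%B by vector_eq.
      apply vnorm_triangle.
    + intros e t x He Ht. exists (t *: e)%B. split; [auto|].
      replace (t *: x - t *: e)%B with (t *: (x - e))%B by vector_eq.
      right. apply vnorm_scal_pos, Ht.
  - intros x. apply le_pointwise_inf; [exists 0%B; exact Hzero|]. intros e He.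
    replace (vnorm (x - e)) with (vnorm (- x - (-1) *: e)).
    + apply dist_to_le. auto.
    + rewrite <- vnorm_opp. f_equal. vector_eq.
Qed.

Definition add_line {Y : Banach} (E : Y -> Prop) (v y : Y) : Prop :=
  exists e c, E e /\ y = (e + c *: v)%B.

Lemma linear_subspace_add_line {Y : Banach} (E : Y -> Prop) (v : Y) :
  linear_subspace E -> linear_subspace (add_line E v).
Proof.
  intros [Hzero [Hadd Hscal]]. split; [|split].
  - exists 0%B, 0. split; [exact Hzero|]. vector_eq.
  - intros x y [e [c [He ->]]] [e' [c' [He' ->]]].
    exists (e + e')%B, (c + c'). split; [auto|]. vector_eq.
  - intros a x [e [c [He ->]]]. exists (a *: e)%B, (a * c). split; [auto|]. vector_eq.
Qed.

(* [f] norms [v] for the seminorm [dist_to E], so [|f (c v)|] is the price of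
   dropping the component [c v]. *)
Lemma dist_to_le_add_line {Y : Banach} (E : Y -> Prop) (v : Y) : linear_subspace E ->
  exists f : dual Y, forall y, dist_to E y <= 2 * dist_to (add_line E v) y + Rabs (f y).
Proof.
  intros HE. pose proof (seminorm_dist_to E HE) as Hq.
  assert (Hq_le : forall y, dist_to E y <= 1 * vnorm y).
  { intros y. rewrite Rmult_1_l. apply dist_to_le_vnorm, HE. }
  destruct (norming_functional (dist_to E) 1 v Hq Hq_le) as [f [Hfv Hf]].
  exists f. intros y.
  assert (Hhalf : (dist_to E y - Rabs (f y)) / 2 <= dist_to (add_line E v) y); [|lra].
  apply le_pointwise_inf.
  { exists 0%B. apply linear_subspace_add_line, HE. }
  intros z [e [c [He Hz]]].
  assert (Hdrop : dist_to E y <= dist_to E (y - z)%B + (dist_to E e + Rabs c * dist_to E v)).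
  { replace y with (y - z + (e + c *: v))%B at 1 by (rewrite Hz; vector_eq).
    pose proof (seminorm_scal_le (dist_to E) c v Hq).
    pose proof (proj1 (proj1 Hq) (y - z)%B (e + c *: v)%B).
    pose proof (proj1 (proj1 Hq) e (c *: v)%B). lra. }
  assert (Hprice : Rabs c * dist_to E v <= Rabs (f y) + Rabs (f (y - z)%B) + Rabs (f e)).
  { rewrite <- Hfv, <- (Rabs_pos_eq (f v)) by (rewrite Hfv; apply seminorm_ge0, Hq).
    rewrite <- Rabs_mult, <- dual_scal.
    replace (c *: v)%B with (y - (y - z) - e)%B by (rewrite Hz; vector_eq).
    rewrite !dual_sub. eapply Rle_trans; [apply Rabs_triang|]. rewrite Rabs_Ropp.
    apply Rplus_le_compat_r. eapply Rle_trans; [apply Rabs_triang|].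
    rewrite Rabs_Ropp. apply Rle_refl. }
  pose proof (dist_to_mem E e He). pose proof (Hf e).
  pose proof (Hf (y - z)%B). pose proof (Hq_le (y - z)%B). lra.
Qed.

Lemma lincomb_cons_split {Y : Banach} (v : Y) (vs : list Y) (c : list (R * Y)) :
  (forall p, In p c -> In (snd p) (v :: vs)) ->
  exists a c', (forall p, In p c' -> In (snd p) vs) /\ lincomb c = (a *: v + lincomb c')%B.
Proof.
  induction c as [|[r w] c IH]; intros Hc.
  - exists 0, nil. split; [intros p []|]. simpl. vector_eq.
  - destruct IH as [a [c' [Hc' Heq]]].
    { intros p Hp. apply Hc. right. exact Hp. }
    change (lincomb ((r, w) :: c)) with (r *: w + lincomb c)%B. rewrite Heq.
    destruct (Hc (r, w) (or_introl eq_refl)) as [Hw|Hw]; simpl in Hw.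
    + subst w. exists (r + a), c'. split; [exact Hc'|]. vector_eq.
    + exists a, ((r, w) :: c'). split.
      * intros p [<-|Hp]; [exact Hw|apply Hc', Hp].
      * change (lincomb ((r, w) :: c')) with (r *: w + lincomb c')%B. vector_eq.
Qed.

Definition spans_modulo {Y : Banach} (E : Y -> Prop) (vs : list Y) : Prop :=
  forall y, exists e (c : list (R * Y)),
    E e /\ (forall p, In p c -> In (snd p) vs) /\ y = (e + lincomb c)%B.

Lemma spans_modulo_cons {Y : Banach} (E : Y -> Prop) (v : Y) (vs : list Y) :
  spans_modulo E (v :: vs) -> spans_modulo (add_line E v) vs.
Proof.
  intros Hspan y. destruct (Hspan y) as [e [c [He [Hc ->]]]].
  destruct (lincomb_cons_split v vs c Hc) as [a [c' [Hc' ->]]].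
  exists (e + a *: v)%B, c'. split; [exists e, a; auto|].
  split; [exact Hc'|vector_eq].
Qed.

Lemma weak_null_dist_to {I : Type} {Y : Banach} (F : (I -> Prop) -> Prop) {HF : Filter F}
    (d : I -> Y) (vs : list Y) : weak_limit F d 0%B ->
  forall E, linear_subspace E -> spans_modulo E vs ->
  forall eps, eps > 0 -> F (fun i => dist_to E (d i) < eps).
Proof.
  intros Hd. induction vs as [|v vs IH]; intros E HE Hspan eps Heps.
  - apply filter_forall. intros i. apply Rle_lt_trans with (2 := Heps), dist_to_mem.
    destruct (Hspan (d i)) as [e [[|p c] [He [Hc ->]]]].
    + simpl. rewrite vadd_0_r. exact He.
    + destruct (Hc p (or_introl eq_refl)).
  - destruct (dist_to_le_add_line E v HE) as [f Hf].
    specialize (IH (add_line E v) (linear_subspace_add_line E v HE) (spans_modulo_cons E v vs Hspan)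
                  (eps / 4) ltac:(lra)).
    pose proof (proj1 (filterlim_locally_R F _ _) (Hd f) (eps / 2) ltac:(lra)) as Hfd.
    apply filter_imp with (2 := filter_and _ _ IH Hfd). intros i [Hdist Hfi].
    rewrite dual_zero, Rminus_0_r in Hfi. specialize (Hf (d i)). lra.
Qed.

Lemma weak_null_near_finite_codim {I : Type} {Y : Banach} (F : (I -> Prop) -> Prop)
    {HF : Filter F} (d : I -> Y) (E : Y -> Prop) (eps : R) :
  weak_limit F d 0%B -> linear_subspace E -> finite_codim E -> eps > 0 ->
  F (fun i => exists e, E e /\ vnorm (d i - e) < eps).
Proof.
  intros Hd HE [vs Hvs] Heps.
  apply filter_imp with (2 := weak_null_dist_to F d vs Hd E HE Hvs eps Heps).
  intros i. apply pointwise_inf_lt_witness. exists 0%B. apply HE.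
Qed.

(** * Asymptotic uniform smoothness *)

Lemma whole_space_closed (Y : Banach) : closed_subspace (fun _ : Y => True).
Proof. repeat split. Qed.

Lemma whole_space_finite_codim (Y : Banach) : finite_codim (fun _ : Y => True).
Proof.
  exists nil. intros y. exists y, nil. split; [exact I|]. split; [intros p []|].
  symmetry. apply vadd_0_r.
Qed.

Lemma finite_codim_unit_vector {Y : Banach} (E : Y -> Prop) :
  linear_subspace E -> finite_codim E -> exists h, E h /\ vnorm h = 1.
Proof.
  intros HE [vs Hvs]. destruct (vinfinite_dim Y vs) as [x Hx].
  destruct (Hvs x) as [e [c [He [Hc Heq]]]].
  assert (Hne : e <> 0%B).
  { intros ->. apply (Hx c Hc). rewrite Heq. apply vadd_0. }
  exists (/ vnorm e *: e)%B.
  split; [apply HE, He|apply vnorm_normalize, Hne].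
Qed.

Lemma vnorm_add_unit_bounds {Y : Banach} (x h : Y) (t : R) :
  0 <= t -> vnorm x = 1 -> vnorm h = 1 -> - t <= vnorm (x + t *: h) - 1 <= t.
Proof.
  intros Ht Hx Hh.
  pose proof (vnorm_triangle _ x (t *: h)%B) as Hupper.
  pose proof (vnorm_sub_le (x + t *: h) (t *: h)) as Hlower.
  replace (x + t *: h - t *: h)%B with x in Hlower by vector_eq.
  rewrite vnorm_scal_pos, Hx, Hh in Hupper, Hlower by exact Ht. lra.
Qed.

Definition growth_on_sphere {Y : Banach} (t : R) (x : Y) (E : Y -> Prop) : R :=
  Rsup (fun u => exists h : Y, E h /\ vnorm h = 1 /\ u = vnorm (x + t *: h) - 1).

Definition subspace_growths {Y : Banach} (t : R) (x : Y) (s : R) : Prop :=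
  exists E, closed_subspace E /\ finite_codim E /\ s = growth_on_sphere t x E.

Lemma subspace_growths_whole_space {Y : Banach} (t : R) (x : Y) :
  subspace_growths t x (growth_on_sphere t x (fun _ => True)).
Proof.
  exists (fun _ => True).
  split; [apply whole_space_closed|]. split; [apply whole_space_finite_codim|reflexivity].
Qed.

Section SubspaceGrowth.

Context {Y : Banach} (t : R).
Hypothesis t_ge0 : 0 <= t.

Lemma le_growth_on_sphere (x h : Y) (E : Y -> Prop) :
  vnorm x = 1 -> E h -> vnorm h = 1 -> vnorm (x + t *: h) - 1 <= growth_on_sphere t x E.
Proof.
  intros Hx HEh Hh. apply le_Rsup with t.
  - intros u [h' [_ [Hh' ->]]]. apply vnorm_add_unit_bounds; assumption.
  - exists h. auto.
Qed.

Lemma growth_on_sphere_bounds (x : Y) (E : Y -> Prop) :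
  vnorm x = 1 -> linear_subspace E -> finite_codim E -> - t <= growth_on_sphere t x E <= t.
Proof.
  intros Hx HE HEc. destruct (finite_codim_unit_vector E HE HEc) as [h [HEh Hh]]. split.
  - apply Rle_trans with (vnorm (x + t *: h) - 1).
    + apply vnorm_add_unit_bounds; assumption.
    + apply le_growth_on_sphere; assumption.
  - apply Rsup_le.
    + exists (vnorm (x + t *: h) - 1), h. auto.
    + intros u [h' [_ [Hh' ->]]]. apply vnorm_add_unit_bounds; assumption.
Qed.

Lemma subspace_growths_bounds (x : Y) (s : R) :
  vnorm x = 1 -> subspace_growths t x s -> - t <= s <= t.
Proof.
  intros Hx [E [HE [HEc ->]]].
  apply growth_on_sphere_bounds; [exact Hx|apply closed_subspace_linear, HE|exact HEc].
Qed.

Lemma Rinf_subspace_growths_le_mod_AUS (x : Y) :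
  vnorm x = 1 -> Rinf (subspace_growths t x) <= mod_AUS Y t.
Proof.
  intros Hx. apply le_Rsup with t.
  - intros r [z [Hz ->]].
    pose proof (subspace_growths_whole_space t z) as Hwhole.
    apply Rle_trans with (2 := proj2 (subspace_growths_bounds z _ Hz Hwhole)).
    apply Rinf_le with (- t); [|exact Hwhole].
    intros s Hs. apply (subspace_growths_bounds z s Hz Hs).
  - exists x. split; [exact Hx|reflexivity].
Qed.

Lemma mod_AUS_lt_subspace (x : Y) (b : R) : vnorm x = 1 -> mod_AUS Y t < b ->
  exists E, closed_subspace E /\ finite_codim E /\
    forall h, E h -> vnorm h = 1 -> vnorm (x + t *: h) <= 1 + b.
Proof.
  intros Hx Hb. pose proof (Rinf_subspace_growths_le_mod_AUS x Hx) as Hinf.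
  destruct (Rinf_lt_witness (subspace_growths t x) b) as [s [[E [HE [HEc ->]]] Hs]].
  - eexists. apply subspace_growths_whole_space.
  - exact (Rle_lt_trans _ _ _ Hinf Hb).
  - exists E. split; [exact HE|]. split; [exact HEc|]. intros h HEh Hh.
    pose proof (le_growth_on_sphere x h E Hx HEh Hh). lra.
Qed.

End SubspaceGrowth.

Lemma vnorm_add_slope_le {Y : Banach} (x h : Y) (s : R) : 1 <= s ->
  s * (vnorm (x + h) - vnorm x) <= vnorm (x + s *: h) - vnorm x.
Proof.
  intros Hs. pose proof (vnorm_triangle _ ((s - 1) *: x) (x + s *: h))%B as Hconvex.
  replace ((s - 1) *: x + (x + s *: h))%B with (s *: (x + h))%B in Hconvex by vector_eq.
  rewrite !vnorm_scal_pos in Hconvex by lra. lra.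
Qed.

Lemma vnorm_add_le_of_normalized {Y : Banach} (x h : Y) (t b : R) :
  x <> 0%B -> h <> 0%B -> 0 < t -> vnorm h <= t * vnorm x ->
  vnorm (/ vnorm x *: x + t *: (/ vnorm h *: h)) <= 1 + b * t ->
  vnorm (x + h) <= vnorm x + b * vnorm h.
Proof.
  intros Hx Hh Ht Hht Hunit. apply vnorm_gt0 in Hx, Hh.
  set (s := t * vnorm x / vnorm h).
  assert (Hs : 1 <= s) by (apply Rle_div_r; lra).
  pose proof (vnorm_add_slope_le x h s Hs) as Hslope.
  replace (x + s *: h)%B with (vnorm x *: (/ vnorm x *: x + t *: (/ vnorm h *: h)))%B
    in Hslope by (unfold s; vector_eq).
  rewrite vnorm_scal_pos in Hslope by lra.
  apply (Rmult_le_compat_l (vnorm x)) in Hunit; [|lra].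
  apply (Rmult_le_reg_l s); [lra|].
  replace (s * (vnorm x + b * vnorm h)) with (s * vnorm x + vnorm x * (b * t))
    by (unfold s; field; lra).
  lra.
Qed.

Lemma AUS_vnorm_add_le (Y : Banach) (eps : R) : AUS Y -> eps > 0 ->
  exists T, 0 < T /\ forall x : Y, x <> 0%B -> exists E, closed_subspace E /\ finite_codim E /\
    forall h, E h -> T * vnorm h <= vnorm x -> vnorm (x + h) <= vnorm x + eps * vnorm h.
Proof.
  intros HY Heps. destruct (HY eps Heps) as [delta [Hdelta Hmod]].
  specialize (Hmod (delta / 2) ltac:(lra)). set (t := delta / 2) in Hmod.
  assert (Ht : 0 < t) by (unfold t; lra).
  assert (Hmod_t : mod_AUS Y t < eps * t).
  { apply Rlt_div_l; [exact Ht|]. apply Rle_lt_trans with (1 := Rle_abs _), Hmod. }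
  exists (/ t). split; [apply Rinv_0_lt_compat, Ht|]. intros x Hx.
  destruct (mod_AUS_lt_subspace t (Rlt_le _ _ Ht) (/ vnorm x *: x)%B (eps * t)
              (vnorm_normalize x Hx) Hmod_t) as [E [HE [HEc Hunit]]].
  exists E. split; [exact HE|]. split; [exact HEc|]. intros h HEh Hh.
  destruct (classic (h = 0%B)) as [->|Hne].
  - rewrite vadd_0_r, vnorm_zero. lra.
  - apply vnorm_add_le_of_normalized with t; [exact Hx|exact Hne|exact Ht| |].
    + apply (Rmult_le_compat_l t) in Hh; [|lra].
      rewrite <- Rmult_assoc, Rinv_r in Hh by lra. lra.
    + apply Hunit; [apply closed_subspace_linear; assumption|apply vnorm_normalize, Hne].
Qed.

Lemma AUS_weak_null_add {I : Type} {Y : Banach} (F : (I -> Prop) -> Prop) {HF : Filter F}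
    (eps : R) : AUS Y -> eps > 0 ->
  exists T, 0 < T /\ forall (x : Y) (d : I -> Y) (L s : R),
    weak_limit F d 0%B -> 0 < L -> (forall i, vnorm (d i) <= L) ->
    vnorm x <= s -> T * L <= s -> F (fun i => vnorm (x + d i) <= s + eps * L).
Proof.
  intros HY Heps. destruct (AUS_vnorm_add_le Y (eps / 3) HY ltac:(lra)) as [T [HT Hsmooth]].
  exists (2 * T + 1). split; [lra|]. intros x d L s Hd HL HdL Hxs HTs.
  destruct (Rle_lt_dec (T * (2 * L)) (vnorm x)) as [Hlong|Hshort].
  - assert (Hx : x <> 0%B).
    { intros ->. rewrite vnorm_zero in Hlong. nra. }
    destruct (Hsmooth x Hx) as [E [HE [HEc Hadd]]].
    set (r := Rmin L (eps / 3 * L)).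
    assert (Hr : r > 0) by (apply Rmin_pos; [|apply Rmult_lt_0_compat]; lra).
    assert (HrL : r <= L) by apply Rmin_l.
    assert (Hreps : r <= eps / 3 * L) by apply Rmin_r.
    apply filter_imp with
      (2 := weak_null_near_finite_codim F d E r Hd (closed_subspace_linear E HE) HEc Hr).
    intros i [e [He Hdist]].
    assert (Hnorm_e : vnorm e <= 2 * L).
    { replace e with (d i - (d i - e))%B by vector_eq.
      pose proof (vnorm_sub_le (d i) (d i - e)). specialize (HdL i). lra. }
    specialize (Hadd e He).
    replace (x + d i)%B with (x + e + (d i - e))%B by vector_eq.
    pose proof (vnorm_triangle _ (x + e) (d i - e))%B. nra.
  - apply filter_forall. intros i.
    pose proof (vnorm_triangle _ x (d i)). specialize (HdL i). nra.
Qed.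

(** * Concentration of Lipschitz maps on Hamming graphs *)

Definition hamming_lipschitz {I : Type} {Y : Banach} (L : R) (f : list I -> Y) : Prop :=
  forall l l' i j, vnorm (f (l ++ i :: l') - f (l ++ j :: l')) <= L.

Fixpoint almost_all {I : Type} (F : (I -> Prop) -> Prop) (k : nat) (P : list I -> Prop) : Prop :=
  match k with
  | O => P nil
  | S k' => F (fun i => almost_all F k' (fun l => P (i :: l)))
  end.

Fixpoint iterated_weak_limit {I : Type} {Y : Banach} (F : (I -> Prop) -> Prop) (k : nat)
    (f : list I -> Y) (z : Y) : Prop :=
  match k with
  | O => f nil = z
  | S k' => exists g : I -> Y,
      (forall i, iterated_weak_limit F k' (fun l => f (i :: l)) (g i)) /\ weak_limit F g z
  end.

Lemma hamming_lipschitz_cons {I : Type} {Y : Banach} (L : R) (f : list I -> Y) (i : I) :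
  hamming_lipschitz L f -> hamming_lipschitz L (fun l => f (i :: l)).
Proof. intros Hf l l'. apply (Hf (i :: l)). Qed.

#[export] Instance almost_all_filter {I : Type} (F : (I -> Prop) -> Prop) {HF : Filter F}
    (k : nat) :
  Filter (almost_all F k).
Proof.
  induction k as [|k IH]; split; cbn [almost_all]; auto.
  - apply filter_forall. intros i. apply filter_true.
  - intros P Q HP HQ. apply filter_imp with (2 := filter_and _ _ HP HQ).
    intros i [HPi HQi]. apply (filter_and _ _ HPi HQi).
  - intros P Q HPQ. apply filter_imp. intros i. apply filter_imp. auto.
Qed.

#[export] Instance almost_all_proper {I : Type} (F : (I -> Prop) -> Prop) {HF : ProperFilter F}
    (k : nat) :
  ProperFilter (almost_all F k).
Proof.
  split; [|exact _]. induction k as [|k IH]; intros P HP; [exists nil; exact HP|].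
  cbn [almost_all] in HP. destruct (filter_ex _ HP) as [i Hi].
  destruct (IH _ Hi) as [l Hl]. exists (i :: l). exact Hl.
Qed.

Lemma iterated_weak_limit_dist_le {I : Type} {Y : Banach} (F : (I -> Prop) -> Prop)
    {HF : ProperFilter F} (k : nat) : forall (f g : list I -> Y) (y z : Y) (C : R),
  iterated_weak_limit F k f y -> iterated_weak_limit F k g z ->
  (forall l, vnorm (f l - g l) <= C) -> vnorm (y - z) <= C.
Proof.
  induction k as [|k IH]; intros f g y z C Hf Hg HC.
  - simpl in Hf, Hg. subst y z. apply HC.
  - destruct Hf as [u [Hu Huy]], Hg as [v [Hv Hvz]].
    apply (weak_limit_dist_le F u v y z C Huy Hvz), filter_forall. intros i.
    apply (IH _ _ _ _ C (Hu i) (Hv i)). intros l. apply HC.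
Qed.

Lemma iterated_weak_limit_exists {I : Type} {Y : Banach} (U : (I -> Prop) -> Prop)
    {HU : Ultrafilter U} (k : nat) : reflexive Y ->
  forall (f : list I -> Y) (L : R), hamming_lipschitz L f ->
    exists z, iterated_weak_limit U k f z.
Proof.
  intros HY. destruct (filter_ex _ (filter_true (F := U))) as [i0 _].
  induction k as [|k IH]; intros f L Hf; [exists (f nil); reflexivity|].
  destruct (functional_choice (fun i => iterated_weak_limit U k (fun l => f (i :: l))))
    as [g Hg].
  { intros i. apply (IH _ L), hamming_lipschitz_cons, Hf. }
  destruct (bounded_weak_limit_exists U g (L + vnorm (g i0)) HY) as [z Hz].
  - intros i. replace (g i) with (g i - g i0 + g i0)%B by vector_eq.
    apply Rle_trans with (1 := vnorm_triangle _ _ _), Rplus_le_compat_r.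
    apply (iterated_weak_limit_dist_le U k _ _ _ _ L (Hg i) (Hg i0)).
    intros l. apply (Hf nil).
  - exists z, g. auto.
Qed.

Section HammingConcentration.

Context {I : Type} {Y : Banach} (U : (I -> Prop) -> Prop) {HU : Ultrafilter U}.
Hypothesis Y_reflexive : reflexive Y.
Hypothesis Y_AUS : AUS Y.

Lemma iterated_weak_limit_concentration (eps : R) : eps > 0 ->
  exists T, 0 < T /\ forall (k : nat) (f : list I -> Y) (L s : R) (y z : Y),
    0 < L -> hamming_lipschitz L f -> iterated_weak_limit U k f y ->
    vnorm (y - z) <= s -> T * L <= s ->
    almost_all U k (fun l => vnorm (f l - z) <= s + eps * L * INR k).
Proof.
  intros Heps. destruct (AUS_weak_null_add U eps Y_AUS Heps) as [T [HT Hstep]].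
  exists T. split; [exact HT|].
  induction k as [|k IH]; intros f L s y z HL Hf Hy Hs HTs.
  - simpl in *. subst y. lra.
  - destruct Hy as [g [Hg Hgy]].
    assert (Hg_close : forall i j, vnorm (g i - g j) <= L).
    { intros i j. apply (iterated_weak_limit_dist_le U k _ _ _ _ L (Hg i) (Hg j)).
      intros l. apply (Hf nil). }
    assert (Hnull : weak_limit U (fun i => g i - y)%B 0%B).
    { replace (0 : Y)%B with (y - y)%B by vector_eq.
      apply weak_limit_sub; [exact _|exact Hgy|apply weak_limit_const, _]. }
    assert (Hbound : forall i, vnorm (g i - y) <= L).
    { intros i. apply (weak_limit_dist_le U (fun _ => g i) g (g i) y L).
      - apply weak_limit_const, _.
      - exact Hgy.
      - apply filter_forall, Hg_close. }
    apply filter_imp with (2 := Hstep (y - z)%B _ L s Hnull HL Hbound Hs HTs).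
    intros i Hi. rewrite S_INR.
    replace (s + eps * L * (INR k + 1)) with (s + eps * L + eps * L * INR k) by ring.
    apply IH with (y := g i); [exact HL|apply hamming_lipschitz_cons, Hf|apply Hg| |nra].
    replace (g i - z)%B with (y - z + (g i - y))%B by vector_eq. exact Hi.
Qed.

Lemma hamming_concentration (eps : R) : eps > 0 ->
  exists K, forall (k : nat) (f : list I -> Y) (L : R),
    (K <= k)%nat -> 0 < L -> hamming_lipschitz L f ->
    exists z, almost_all U k (fun l => vnorm (f l - z) <= eps * L * INR k).
Proof.
  intros Heps.
  destruct (iterated_weak_limit_concentration (eps / 2)) as [T [HT Hconc]]; [lra|].
  destruct (INR_archimed (eps / 2) T) as [K HK]; [lra|].
  exists K. intros k f L HKk HL Hf.
  destruct (iterated_weak_limit_exists U k Y_reflexive f L Hf) as [z Hz]. exists z.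
  replace (eps * L * INR k) with (eps / 2 * INR k * L + eps / 2 * L * INR k) by field.
  apply le_INR in HKk.
  apply (Hconc k f L (eps / 2 * INR k * L) z z HL Hf Hz).
  - replace (z - z)%B with (0 : Y)%B by vector_eq. rewrite vnorm_zero.
    pose proof (pos_INR k). repeat apply Rmult_le_pos; lra.
  - apply Rmult_le_compat_r; nra.
Qed.

End HammingConcentration.

(** * Means of blocks of a bounded sequence *)

Definition list_vsum {I : Type} {X : Banach} (x : I -> X) (l : list I) : X :=
  fold_right (fun i s => x i + s)%B 0%B l.

Lemma list_vsum_app {I : Type} {X : Banach} (x : I -> X) (l l' : list I) :
  list_vsum x (l ++ l') = (list_vsum x l + list_vsum x l')%B.
Proof.
  induction l as [|i l IH]; simpl; [symmetry; apply vadd_0|].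
  rewrite IH. apply vadd_assoc.
Qed.

Lemma list_vsum_map {I J : Type} {X : Banach} (x : J -> X) (phi : I -> J) (l : list I) :
  list_vsum x (map phi l) = list_vsum (fun i => x (phi i)) l.
Proof. induction l as [|i l IH]; simpl; [reflexivity|]. rewrite IH. reflexivity. Qed.

Lemma coarse_lipschitz_embedding_bounds {X Y : Banach} (f : X -> Y) :
  coarse_lipschitz_embedding f ->
  exists L, L > 0 /\ forall x y,
    vnorm (f x - f y) <= L * vnorm (x - y) + L /\
    vnorm (x - y) <= L * vnorm (f x - f y) + L * L.
Proof.
  intros [L [HL [Hupper Hlower]]]. exists L. split; [exact HL|]. intros x y.
  pose proof (vnorm_ge0 (x - y)) as Hxy. split.
  - apply Hupper; lra.
  - specialize (Hlower (vnorm (x - y)) ltac:(lra) x y ltac:(lra)).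
    apply Rge_le, (Rmult_le_compat_l L) in Hlower; [|lra].
    replace (L * (vnorm (x - y) / L - L)) with (vnorm (x - y) - L * L) in Hlower by (field; lra).
    lra.
Qed.

Lemma hamming_lipschitz_list_vsum {I : Type} {X Y : Banach} (f : X -> Y) (x : I -> X)
    (A B M lam : R) :
  (forall u v, vnorm (f u - f v) <= A * vnorm (u - v) + B) -> (forall i, vnorm (x i) <= M) ->
  0 <= A -> 0 <= lam ->
  hamming_lipschitz (A * (lam * (2 * M)) + B) (fun l => f (lam *: list_vsum x l)%B).
Proof.
  intros Hf Hx HA Hlam l l' i j. eapply Rle_trans; [apply Hf|].
  apply Rplus_le_compat_r, Rmult_le_compat_l; [exact HA|].
  rewrite !list_vsum_app. simpl.
  match goal with |- vnorm ?w <= _ =>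
    replace w with (lam *: (x i - x j))%B by vector_eq end.
  rewrite vnorm_scal_pos by exact Hlam. apply Rmult_le_compat_l; [exact Hlam|].
  pose proof (vnorm_sub_le (x i) (x j)). pose proof (Hx i). pose proof (Hx j). lra.
Qed.

Definition block_means_concentrate {I : Type} {X : Banach} (F : (I -> Prop) -> Prop) (x : I -> X) :
    Prop :=
  forall eta, eta > 0 -> exists k c, (0 < k)%nat /\
    almost_all F k (fun l => vnorm (list_vsum x l - INR k *: c) <= eta * INR k).

Lemma dilated_dist_le {X Y : Banach} (f : X -> Y) (L lam : R) (u v : X) (z : Y) :
  (forall x y, vnorm (x - y) <= L * vnorm (f x - f y) + L * L) -> 0 <= L -> 0 <= lam ->
  lam * vnorm (u - v) <=
    L * (vnorm (f (lam *: u)%B - z) + vnorm (f (lam *: v)%B - z)) + L * L.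
Proof.
  intros Hf HL Hlam. rewrite <- vnorm_scal_pos by exact Hlam.
  replace (lam *: (u - v))%B with (lam *: u - lam *: v)%B by vector_eq.
  apply Rle_trans with (1 := Hf _ _), Rplus_le_compat_r, Rmult_le_compat_l; [exact HL|].
  rewrite (vnorm_sub_sym (f (lam *: v)%B)). apply vnorm_sub_triangle.
Qed.

(* Dilating by a large factor [lam] before applying [f] makes the additive
   constants of the coarse embedding negligible. *)
Lemma coarse_embedding_block_sums_close {I : Type} {X Y : Banach} (U : (I -> Prop) -> Prop)
    {HU : Ultrafilter U} (x : I -> X) (M eta : R) :
  reflexive Y -> AUS Y -> coarse_lipschitz_embeds X Y ->
  0 <= M -> (forall i, vnorm (x i) <= M) -> eta > 0 ->
  exists k P, (0 < k)%nat /\ almost_all U k P /\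
    forall l l', P l -> P l' -> vnorm (list_vsum x l - list_vsum x l') <= eta * INR k.
Proof.
  intros HY HA [f Hf] HM Hx Heta.
  destruct (coarse_lipschitz_embedding_bounds f Hf) as [L [HL Hbounds]].
  set (lam := 1 + 2 * (L * L) / eta).
  assert (Hlam : lam * eta = eta + 2 * (L * L)) by (unfold lam; field; lra).
  assert (Hlam1 : 1 <= lam) by nra.
  set (Lip := L * (lam * (2 * M)) + L).
  assert (HLip : 0 < Lip) by (unfold Lip; assert (0 <= lam * (2 * M)) by nra; nra).
  destruct (hamming_concentration U HY HA (lam * eta / (4 * L * Lip))) as [K HK].
  { apply Rdiv_lt_0_compat; repeat apply Rmult_lt_0_compat; lra. }
  destruct (HK (S K) (fun l => f (lam *: list_vsum x l)%B) Lip) as [z Hz]; [lia|exact HLip| |].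
  { apply hamming_lipschitz_list_vsum; [apply Hbounds|exact Hx|lra|lra]. }
  assert (Hk : 1 <= INR (S K)) by (apply (le_INR 1); lia).
  replace (lam * eta / (4 * L * Lip) * Lip * INR (S K)) with (lam * eta * INR (S K) / (4 * L))
    in Hz by (field; lra).
  eexists (S K), _. split; [lia|]. split; [exact Hz|]. intros l l' Hl Hl'.
  apply (Rmult_le_reg_l lam); [lra|].
  apply Rle_trans with
    (L * (lam * eta * INR (S K) / (4 * L) + lam * eta * INR (S K) / (4 * L)) + L * L).
  - eapply Rle_trans; [apply (dilated_dist_le f L lam _ _ z); [apply Hbounds|lra|lra]|].
    apply Rplus_le_compat_r, Rmult_le_compat_l; [lra|]. apply Rplus_le_compat; assumption.
  - replace (L * (lam * eta * INR (S K) / (4 * L) + lam * eta * INR (S K) / (4 * L)))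
      with (lam * eta * INR (S K) / 2) by (field; lra).
    nra.
Qed.

Lemma coarse_embedding_block_means {I : Type} {X Y : Banach} (U : (I -> Prop) -> Prop)
    {HU : Ultrafilter U} (x : I -> X) (M : R) :
  reflexive Y -> AUS Y -> coarse_lipschitz_embeds X Y -> (forall i, vnorm (x i) <= M) ->
  block_means_concentrate U x.
Proof.
  intros HY HA Hembeds Hx eta Heta.
  assert (HM : 0 <= M).
  { destruct (filter_ex _ (filter_true (F := U))) as [i _].
    apply Rle_trans with (1 := vnorm_ge0 (x i)), Hx. }
  destruct (coarse_embedding_block_sums_close U x M eta HY HA Hembeds HM Hx Heta)
    as [k [P [Hk [HP Hclose]]]].
  destruct (filter_ex _ HP) as [l0 Hl0].
  exists k, (/ INR k *: list_vsum x l0)%B. split; [exact Hk|].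
  apply filter_imp with (2 := HP). intros l Hl. apply (lt_INR 0) in Hk. simpl in Hk.
  replace (INR k *: (/ INR k *: list_vsum x l0))%B with (list_vsum x l0) by vector_eq.
  apply Hclose; assumption.
Qed.

(** * Diagonal subsequences *)

(* Lists longer than [k] are left unconstrained. *)
Fixpoint almost_completable {I : Type} (F : (I -> Prop) -> Prop) (k : nat) (P : list I -> Prop)
    (l : list I) {struct l} : Prop :=
  match l, k with
  | nil, _ => almost_all F k P
  | _ :: _, O => True
  | i :: l', S k' => almost_completable F k' (fun l => P (i :: l)) l'
  end.

Lemma almost_completable_snoc {I : Type} (F : (I -> Prop) -> Prop) {HF : Filter F} (l : list I) :
  forall (k : nat) (P : list I -> Prop), almost_completable F k P l ->
    F (fun i => almost_completable F k P (l ++ i :: nil)).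
Proof.
  induction l as [|j l IH]; intros [|k] P Hl; simpl.
  - apply filter_true.
  - exact Hl.
  - apply filter_true.
  - apply IH, Hl.
Qed.

Lemma almost_completable_full {I : Type} (F : (I -> Prop) -> Prop) (l : list I) :
  forall P : list I -> Prop, almost_completable F (length l) P l -> P l.
Proof. induction l as [|i l IH]; intros P Hl; [exact Hl|]. apply (IH _ Hl). Qed.

Lemma increasing_branch (F : (nat -> Prop) -> Prop) {HF : ProperFilter F}
    (Q : list nat -> Prop) : filter_le F eventually ->
  Q nil -> (forall l, Q l -> F (fun n => Q (l ++ n :: nil))) ->
  exists phi : nat -> nat, (forall j, (phi j < phi (S j))%nat) /\
    forall r, Q (map phi (seq 0 r)).
Proof.
  intros Hfree Hnil Hsnoc.
  destruct (functional_choice (fun l n => Q l -> (last l O < n)%nat /\ Q (l ++ n :: nil)))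
    as [next Hnext].
  { intros l. destruct (classic (Q l)) as [Hl|Hl]; [|exists O; contradiction].
    destruct (filter_ex (F := F) (fun n => (last l O < n)%nat /\ Q (l ++ n :: nil))) as [n Hn].
    - apply filter_and; [|apply Hsnoc, Hl]. apply Hfree. exists (S (last l O)). lia.
    - exists n. auto. }
  pose (prefix := fix prefix (r : nat) : list nat :=
    match r with O => nil | S r' => prefix r' ++ next (prefix r') :: nil end).
  assert (HQ : forall r, Q (prefix r)).
  { induction r as [|r IH]; [exact Hnil|]. apply Hnext, IH. }
  exists (fun r => next (prefix r)). split.
  - intros j. destruct (Hnext (prefix (S j)) (HQ (S j))) as [Hlast _].
    simpl prefix in Hlast at 1. rewrite last_last in Hlast. exact Hlast.
  - intros r. replace (map (fun r => next (prefix r)) (seq 0 r)) with (prefix r); [apply HQ|].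
    induction r as [|r IH]; [reflexivity|].
    rewrite seq_S, map_app. simpl. rewrite <- IH. reflexivity.
Qed.

Lemma diagonal_subsequence (F : (nat -> Prop) -> Prop) {HF : ProperFilter F}
    (k : nat -> nat) (P : nat -> list nat -> Prop) : filter_le F eventually ->
  (forall i, almost_all F (k i) (P i)) ->
  exists phi : nat -> nat, (forall j, (phi j < phi (S j))%nat) /\
    forall i a, (i <= a)%nat -> P i (map phi (seq a (k i))).
Proof.
  intros Hfree HP.
  pose (Q := fun l : list nat => forall a, (a < S (length l))%nat -> forall i, (i < S a)%nat ->
    almost_completable F (k i) (P i) (skipn a l)).
  destruct (increasing_branch F Q Hfree) as [phi [Hphi HQ]].
  - intros a _ i _. rewrite skipn_nil. apply HP.
  - intros l Hl.
    assert (Hstarted : F (fun n => forall a, (a < S (length l))%nat -> forall i, (i < S a)%nat ->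
              almost_completable F (k i) (P i) (skipn a l ++ n :: nil))).
    { apply filter_forall_lt; [exact _|]. intros a Ha.
      apply filter_forall_lt; [exact _|]. intros i Hi.
      apply almost_completable_snoc; [exact _|]. apply Hl; assumption. }
    apply filter_imp with (2 := Hstarted). intros n Hn a Ha i Hi.
    destruct (Nat.lt_ge_cases a (S (length l))) as [Hold|Hnew].
    + rewrite skipn_app. replace (a - length l)%nat with O by lia. apply Hn; assumption.
    + rewrite skipn_all2 by (rewrite length_app; simpl; lia). apply HP.
  - exists phi. split; [exact Hphi|]. intros i a Hia.
    specialize (HQ (a + k i)%nat a). rewrite length_map, length_seq in HQ.
    specialize (HQ ltac:(lia) i ltac:(lia)).
    rewrite skipn_map, skipn_seq in HQ. replace (a + k i - a)%nat with (k i) in HQ by lia.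
    apply (almost_completable_full F). rewrite length_map, length_seq. exact HQ.
Qed.

(** * Cesaro means *)

Lemma vsum_add {X : Banach} (y : nat -> X) (a k : nat) :
  vsum y (a + k) = (vsum y a + list_vsum y (seq a k))%B.
Proof.
  induction k as [|k IH].
  - rewrite Nat.add_0_r. symmetry. apply vadd_0_r.
  - rewrite Nat.add_succ_r, seq_S, list_vsum_app. simpl. rewrite IH. vector_eq.
Qed.

Lemma vsum_sub_multiple_le {X : Banach} (y : nat -> X) (c : X) (M : R) (n : nat) :
  (forall j, vnorm (y j) <= M) ->
  vnorm (vsum y n - INR n *: c) <= INR n * (M + vnorm c).
Proof.
  intros Hy. induction n as [|n IH].
  - simpl. replace (0 - 0 *: c)%B with (0 : X)%B by vector_eq. rewrite vnorm_zero. lra.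
  - rewrite S_INR. simpl vsum.
    replace (vsum y n + y n - (INR n + 1) *: c)%B
      with (vsum y n - INR n *: c + (y n - c))%B by vector_eq.
    pose proof (vnorm_triangle _ (vsum y n - INR n *: c) (y n - c))%B.
    pose proof (vnorm_sub_le (y n) c). specialize (Hy n). lra.
Qed.

Section CesaroMeans.

Context {X : Banach} (y : nat -> X) (c : X) (M eta : R) (i k : nat).
Hypothesis y_bounded : forall j, vnorm (y j) <= M.
Hypothesis eta_pos : eta > 0.
Hypothesis k_pos : (0 < k)%nat.
Hypothesis blocks_near : forall a, (i <= a)%nat ->
  vnorm (list_vsum y (seq a k) - INR k *: c) <= eta * INR k.

Lemma vsum_near_multiple (n : nat) :
  vnorm (vsum y n - INR n *: c) <= INR (i + k) * (M + vnorm c) + eta * INR n.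
Proof.
  assert (HM : 0 <= M) by apply (Rle_trans _ _ _ (vnorm_ge0 (y O)) (y_bounded O)).
  induction n as [n IH] using (well_founded_induction Nat.lt_wf_0).
  pose proof (pos_INR n). pose proof (vnorm_ge0 c).
  destruct (Nat.lt_ge_cases n (i + k)) as [Hn|Hn].
  - apply Rle_trans with (1 := vsum_sub_multiple_le y c M n y_bounded).
    assert (INR n <= INR (i + k)) by (apply le_INR; lia). nra.
  - replace n with (n - k + k)%nat by lia.
    specialize (IH (n - k)%nat ltac:(lia)). pose proof (blocks_near (n - k) ltac:(lia)).
    set (m := (n - k)%nat) in *. rewrite vsum_add, (plus_INR m).
    replace (vsum y m + list_vsum y (seq m k) - (INR m + INR k) *: c)%B
      with (vsum y m - INR m *: c + (list_vsum y (seq m k) - INR k *: c))%B by vector_eq.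
    pose proof (vnorm_triangle _ (vsum y m - INR m *: c)
                  (list_vsum y (seq m k) - INR k *: c))%B. lra.
Qed.

Lemma cesaro_eventually_near :
  exists N, forall n, (n >= N)%nat -> vnorm (/ INR (S n) *: vsum y (S n) - c) <= 2 * eta.
Proof.
  destruct (INR_archimed eta (INR (i + k) * (M + vnorm c)) eta_pos) as [N HN].
  exists N. intros n Hn. pose proof (vsum_near_multiple (S n)) as Hnear.
  assert (HNn : INR N <= INR (S n)) by (apply le_INR; lia).
  assert (Hn0 : 0 < INR (S n)) by (apply lt_0_INR; lia).
  replace (/ INR (S n) *: vsum y (S n) - c)%B
    with (/ INR (S n) *: (vsum y (S n) - INR (S n) *: c))%B by vector_eq.
  rewrite vnorm_scal_pos by (apply Rlt_le, Rinv_0_lt_compat, Hn0).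
  rewrite Rmult_comm. apply Rle_div_l; [exact Hn0|]. nra.
Qed.

End CesaroMeans.

Lemma cesaro_convergent_subsequence {X : Banach} (F : (nat -> Prop) -> Prop)
    {HF : ProperFilter F} (x : nat -> X) (M : R) :
  filter_le F eventually -> (forall n, vnorm (x n) <= M) -> block_means_concentrate F x ->
  exists phi : nat -> nat, (forall j, (phi j < phi (S j))%nat) /\
    exists z, converges_to
      (fun n => / INR (S n) *: vsum (fun j => x (phi j)) (S n))%B z.
Proof.
  intros Hfree Hx Hblocks.
  assert (Hpos : forall i, / INR (S i) > 0).
  { intros i. apply Rinv_0_lt_compat, lt_0_INR. lia. }
  destruct (functional_choice (fun (i : nat) (kc : nat * X) => (0 < fst kc)%nat /\
              almost_all F (fst kc) (fun l =>
                vnorm (list_vsum x l - INR (fst kc) *: snd kc) <= / INR (S i) * INR (fst kc))))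
    as [kc Hkc].
  { intros i. destruct (Hblocks (/ INR (S i)) (Hpos i)) as [k [c Hkc]].
    exists (k, c). exact Hkc. }
  destruct (diagonal_subsequence F (fun i => fst (kc i)) _ Hfree (fun i => proj2 (Hkc i)))
    as [phi [Hphi Hdiagonal]].
  exists phi. split; [exact Hphi|].
  apply converges_to_of_approximate_limits. intros eps Heps.
  destruct (archimed_cor1 (eps / 2)) as [i [Hi Hi0]]; [lra|].
  assert (Heta : / INR (S i) <= / INR i).
  { apply Rinv_le_contravar; [apply lt_0_INR, Hi0|apply le_INR; lia]. }
  destruct (cesaro_eventually_near (fun j => x (phi j)) (snd (kc i)) M (/ INR (S i)) i
              (fst (kc i))) as [N HN].
  - intros j. apply Hx.
  - apply Hpos.
  - apply Hkc.
  - intros a Ha. rewrite <- list_vsum_map. apply Hdiagonal, Ha.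
  - exists (snd (kc i)), N. intros n Hn. specialize (HN n Hn). lra.
Qed.

Theorem theorem1p1 (X Y : Banach) :
  reflexive Y -> AUS Y -> coarse_lipschitz_embeds X Y -> banach_saks X.
Proof.
  intros HY HA Hembeds x [M HM].
  destruct (ultrafilter_refinement eventually) as [U [HU Hfree]].
  apply (cesaro_convergent_subsequence U x M Hfree HM).
  apply (coarse_embedding_block_means U x M HY HA Hembeds HM).
Qed.
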